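(* Let $p$ be an odd prime, $e$ a positive integer, $q=p^e$ and $Q=q^2$. Let $M(X,Y)=XY-2^{-1}t_{(Q+1)/2}(X)\,t_q(Y)$. Let $T_2\in\mathbb{F}_Q[X,Y,Z]$ be the polynomial defined by $$T_2(X,Y,Z) = M(X,Y) + Z + t_q(X)\,t_q(Y)\,t_q(Z)\sum_{i=0}^{q-2}h_i(X)\,t_q(Y)^{i}\,t_q(Z)^{q-2-i},$$ where $$h_i(X) = (-4)^{-(i+1)}\sum_{j=0}^{i} \mathcal{T}[i-j,j]\,X^{j(q-1)+i},$$ and let $T\in\mathbb{F}_Q[X,Y,Z]$ be the polynomial defined by $$T(X,Y,Z) = M(X,Y) + Z - \sum_{i=0}^{q-2}g_i(X)\,t_q(Y)^{i+1}\,t_q(Z)^{q-(i+1)},$$ where $$g_i(X) = (-4)^{-(i+1)}\sum_{j=0}^{i+1} C[j(q-1)+i]\,X^{j(q-1)+i+1}.$$ Then $T_2=T$.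
   Context: $\mathbb{F}_Q$ is the finite field with $Q$ elements. $t_n(X)=X^n-X$. For integers $n,k\ge 0$, $C[n]=\frac{1}{n+1}\binom{2n}{n}$ is the $n$-th Catalan number and $\mathcal{T}[n,k]=\binom{2n}{n}\binom{2k}{k}\frac{2k+1}{n+k+1}$ is the generalized Catalan number (an integer). Integers (and inverses of integers prime to $p$) are read in $\mathbb{F}_p\subset\mathbb{F}_Q$ when used as coefficients. *)

(* Defs.v *)
From mathcomp Require Import all_boot all_order all_algebra all_field.
From mathcomp Require Import zify ring.
From mathcomp Require Import mpoly.

Set Implicit Arguments.
Unset Strict Implicit.
Unset Printing Implicit Defensive.

Import GRing.Theory.

Definition catalan (n : nat) : nat := 'C(2 * n, n) %/ n.+1.

Definition gcatalan (n k : nat) : nat :=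
  ('C(2 * n, n) * 'C(2 * k, k) * (2 * k).+1) %/ (n + k).+1.

(* Both quotients are exact, so the truncated division loses nothing. *)
Lemma catalan_exact n : catalan n * n.+1 = 'C(2 * n, n).
Proof.
apply: divnK.
have cop : coprime n.+1 n by rewrite coprime_sym coprimenS.
rewrite -(Gauss_dvdr _ cop).
have := mul_bin_left (2 * n) n.
have -> : 2 * n - n = n by lia.
by move=> <-; rewrite dvdn_mulr.
Qed.

Lemma central_bin_rec n : n.+1 * 'C(2 * n.+1, n.+1) = 2 * (2 * n).+1 * 'C(2 * n, n).
Proof.
have e1 := mul_bin_diag (2 * n).+2 n.
have e2 := mul_bin_down (2 * n).+1 n.
have e4 : n.+1 * 'C((2 * n).+1, n) = (2 * n).+1 * 'C(2 * n, n).
  by rewrite /= in e2; rewrite e2; congr (_ * _); lia.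
have -> : 2 * n.+1 = (2 * n).+2 by lia.
rewrite -e1 /=.
have -> : (2 * n).+2 * 'C((2 * n).+1, n) = 2 * (n.+1 * 'C((2 * n).+1, n)) by lia.
by rewrite e4 mulnA.
Qed.

Lemma gcatalan_exact n k :
  gcatalan n k * (n + k).+1 = 'C(2 * n, n) * 'C(2 * k, k) * (2 * k).+1.
Proof.
apply: divnK.
elim: k n => [|k IHk] n.
  by rewrite muln0 bin0 !muln1 addn0 -catalan_exact dvdn_mull.
have /dvdnP[a Ha] := IHk n.+1.
apply/dvdnP; exists (a + catalan n * 'C(2 * k.+1, k.+1)).
apply/eqP; rewrite -(eqn_pmul2l (ltn0Sn k)) -(eqn_pmul2l (ltn0Sn n)); apply/eqP.
have Hk := central_bin_rec k.
have Hn := central_bin_rec n.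
have Hc := catalan_exact n.
move: Ha Hk Hn Hc; rewrite !addSn !addnS.
set u := 'C(2 * n.+1, _); set v := 'C(2 * k.+1, _).
set w := 'C(2 * n, n); set x := 'C(2 * k, k); set c := catalan n.
move=> Ha Hk Hn Hc.
have -> : n.+1 * (k.+1 * (w * v * (2 * k.+1).+1))
        = n.+1 * w * (2 * k.+1).+1 * (k.+1 * v) by ring.
have -> : n.+1 * (k.+1 * ((a + c * v) * (n + k).+2))
        = k.+1 * (n.+1 * (a * (n + k).+2)) + (c * n.+1) * (k.+1 * v) * (n + k).+2 by ring.
rewrite -Ha Hc Hk.
have -> : n.+1 * (u * x * (2 * k).+1) = (n.+1 * u) * x * (2 * k).+1 by ring.
by rewrite Hn; ring.
Qed.

Local Open Scope ring_scope.

Definition t (A : nzRingType) (n : nat) (x : A) : A := x ^+ n - x.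

Section Polynomials.
Variables (F : fieldType) (q : nat).
Implicit Types x : {mpoly F[3]}.

Definition X : {mpoly F[3]} := 'X_(inord 0).
Definition Y : {mpoly F[3]} := 'X_(inord 1).
Definition Z : {mpoly F[3]} := 'X_(inord 2).

(* (Q + 1) / 2 with Q = q ^ 2; ./2 is exact since q is odd in the theorem. *)
Definition M : {mpoly F[3]} :=
  X * Y - (2%:R : F)^-1 *: (t (q ^ 2).+1./2 X * t q Y).

Definition h (i : nat) x : {mpoly F[3]} :=
  (- 4%:R : F) ^- i.+1 *:
    \sum_(j < i.+1) (gcatalan (i - j) j)%:R *: x ^+ (j * (q - 1) + i).

Definition g (i : nat) x : {mpoly F[3]} :=
  (- 4%:R : F) ^- i.+1 *:
    \sum_(j < i.+2) (catalan (j * (q - 1) + i))%:R *: x ^+ (j * (q - 1) + i + 1).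

Definition T2 : {mpoly F[3]} :=
  M + Z + t q X * t q Y * t q Z *
    \sum_(i < q - 1) h i X * t q Y ^+ i * t q Z ^+ (q - 2 - i).

Definition T : {mpoly F[3]} :=
  M + Z - \sum_(i < q - 1) g i X * t q Y ^+ i.+1 * t q Z ^+ (q - i.+1).

End Polynomials.

(* Main.v *)
(* Since [t_q(X) X^(j(q-1)+i) = X^((j+1)(q-1)+i+1) - X^(j(q-1)+i+1)], the claim
   [t_q(X) h_i(X) = - g_i(X)] compares coefficients:
   [C[j(q-1)+i] = T[i-j,j] - T[i-j+1,j-1]] modulo p.  With r = i-j+1 the right-hand
   side is the integer [C[r-1] binom(2j,j)] (or [- binom(2j,j) / 2] if r = 0), while
   [2 C[n] = 4 binom(2n,n) - binom(2n+2,n+1)] and Lucas' congruence in base q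
   reduce [C[jq+r-1]] to the same value. *)
Require Import Defs.
From mathcomp Require Import all_boot all_order all_algebra all_field.
From mathcomp Require Import zify ring.
From mathcomp Require Import mpoly.

Set Implicit Arguments.
Unset Strict Implicit.
Unset Printing Implicit Defensive.

Import GRing.Theory.

Notation central n := 'C(2 * n, n).

(** Expresses [catalan] linearly in central binomials, so that congruences for these pass to it once
    2 is invertible. *)
Lemma catalan_central n : 2 * catalan n + central n.+1 = 4 * central n.
Proof.
apply/eqP; rewrite -(eqn_pmul2l (ltn0Sn n)); apply/eqP.
have := catalan_exact n; have := central_bin_rec n.
set u := central n.+1; set v := central n; set c := catalan n.
move=> Hu Hc.
have -> : n.+1 * (2 * c + u) = 2 * (c * n.+1) + n.+1 * u by ring.
by rewrite Hc Hu; ring.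
Qed.

Lemma gcatalan0r n : gcatalan n 0 = catalan n.
Proof. by rewrite /gcatalan /catalan muln0 bin0 !muln1 addn0. Qed.

Lemma gcatalan0l k : 2 * gcatalan 0 k = central k.+1.
Proof.
apply/eqP; rewrite -(eqn_pmul2l (ltn0Sn k)); apply/eqP.
have := gcatalan_exact 0 k; rewrite add0n muln0 bin0 mul1n => H.
by rewrite central_bin_rec mulnCA (mulnC k.+1) H; ring.
Qed.

(** Both [gcatalan] terms have the denominator r+j+2. Clearing it together with r+1 and j+1 lets
    [central_bin_rec] reduce everything to a polynomial identity. *)
Lemma gcatalan_shift r j :
  gcatalan r j.+1 = gcatalan r.+1 j + catalan r * central j.+1.
Proof.
apply/eqP; rewrite -(eqn_pmul2r (ltn0Sn (r + j).+1)); apply/eqP.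
have := gcatalan_exact r j.+1; have := gcatalan_exact r.+1 j.
rewrite addnS addSn => H1 ->; rewrite mulnDl H1.
apply/eqP; rewrite -(eqn_pmul2l (ltn0Sn j)) -(eqn_pmul2l (ltn0Sn r)); apply/eqP.
have := catalan_exact r; have := central_bin_rec r; have := central_bin_rec j.
set u := central r.+1; set v := central j.+1; set w := central r.
set x := central j; set c := catalan r => Hv Hu Hc.
have -> : r.+1 * (j.+1 * (w * v * (2 * j.+1).+1))
        = r.+1 * w * (2 * j.+1).+1 * (j.+1 * v) by ring.
have -> : r.+1 * (j.+1 * (u * x * (2 * j).+1 + c * v * (r + j).+2))
        = j.+1 * (r.+1 * u) * x * (2 * j).+1 + (c * r.+1) * (j.+1 * v) * (r + j).+2
  by ring.
by rewrite Hv Hu Hc; ring.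
Qed.

Local Open Scope ring_scope.

Section PrimePowerCongruences.
Variables (F : fieldType) (q : nat).
Hypotheses (q_gt0 : (0 < q)%N) (q_char : [pchar F].-nat q).

(** Coefficient of X^k in (X+1)^(q+n) = (X^q+1)(X+1)^n, by Frobenius. *)
Lemma bin_addq n k :
  'C(q + n, k)%:R = 'C(n, k)%:R + (if (k < q)%N then 0 else 'C(n, k - q)%:R) :> F.
Proof.
have coefB m l : (('X + 1 : {poly F}) ^+ m)`_l = 'C(m, l)%:R.
  rewrite addrC exprDn.
  under eq_bigr do rewrite expr1n mul1r.
  rewrite coef_sum.
  under eq_bigr do rewrite coefMn coefXn.
  case: (ltnP l m.+1) => [lm|ml].
    rewrite (bigD1 (Ordinal lm)) //= eqxx big1 ?addr0 // => i ne.
    case: eqP => [E|]; last by rewrite mul0rn.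
    by case/eqP: ne; apply: val_inj.
  rewrite bin_small // big1 // => i _.
  case: eqP => [E|]; last by rewrite mul0rn.
  by move: (ltn_ord i); rewrite -E ltnNge ml.
rewrite -!coefB exprD exprDn_pchar; last by rewrite (eq_pnat _ (pchar_poly F)).
by rewrite expr1n mulrDl mul1r coefD coefXnM addrC coefB.
Qed.

(** Induction on the leading part a: [bin_addq] is Pascal's rule for the pair (a, c). *)
Lemma Lucas_bin a b c d : (b < q)%N -> (d < q)%N ->
  'C(a * q + b, c * q + d)%:R = ('C(a, c) * 'C(b, d))%:R :> F.
Proof.
move=> bq dq; elim: a c => [|a IHa] [|c].
- by rewrite bin0 mul1n.
- by rewrite bin0n mul0n add0n /= bin_small // mulSn -addnA ltn_addr.
- rewrite mulSn -addnA bin_addq mul0n add0n dq addr0.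
  by have := IHa 0%N; rewrite mul0n add0n !bin0.
- have -> : (a.+1 * q + b = q + (a * q + b))%N by rewrite mulSn addnA.
  have -> : (c.+1 * q + d = q + (c * q + d))%N by rewrite mulSn addnA.
  rewrite bin_addq ltnNge leq_addr /= addKn IHa.
  have -> : (q + (c * q + d) = c.+1 * q + d)%N by rewrite mulSn addnA.
  by rewrite IHa -natrD binS mulnDl.
Qed.

Lemma Lucas_central j r : (r < q)%N ->
  (central (j * q + r))%:R = (central j * central r)%:R :> F.
Proof.
move=> rq; case: (ltnP (2 * r) q) => [r2|r2].
  have -> : (2 * (j * q + r) = (2 * j) * q + 2 * r)%N by ring.
  (* No carry: doubling acts separately on j and on r. *)
  by rewrite Lucas_bin.
(* Doubling r carries, leaving the low digit 2r-q < r, so both sides vanish. *)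
have lt1 : (2 * r - q < q)%N by lia.
have lt2 : (2 * r - q < r)%N by lia.
have -> : (2 * (j * q + r) = (2 * j).+1 * q + (2 * r - q))%N by nia.
have e : (central r)%:R = 0 :> F.
  have := Lucas_bin 1 0 lt1 rq; rewrite mul1n mul0n add0n subnKC // => ->.
  by rewrite (bin_small lt2) muln0.
by rewrite Lucas_bin // (bin_small lt2) muln0 natrM e mulr0.
Qed.

Hypotheses (two_neq0 : 2%:R != 0 :> F) (q_gt1 : (1 < q)%N).

Lemma double_catalanE n :
  2%:R * (catalan n)%:R = 4%:R * (central n)%:R - (central n.+1)%:R :> F.
Proof.
by rewrite -!natrM -catalan_central natrD addrK.
Qed.

(** The bound on r gives jq+r and its successor the same leading part j, so the central factor of j
    comes out of [double_catalanE]. *)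
Lemma catalan_Lucas j r : (r.+1 < q)%N ->
  (catalan (j * q + r))%:R = (central j * catalan r)%:R :> F.
Proof.
move=> rq; apply: (mulfI two_neq0).
rewrite double_catalanE -addnS !Lucas_central // 1?ltnW // !natrM.
by rewrite mulrCA -mulrBr -double_catalanE mulrCA.
Qed.

(** Here the successor carries to (j+1)q, and the other term vanishes because q divides
    [central q.-1]. What remains is minus the central binomial of j+1, which is twice
    [gcatalan 0 j]. *)
Lemma catalan_Lucas_pred j :
  (catalan (j * q + q.-1))%:R = - (gcatalan 0 j)%:R :> F.
Proof.
apply: (mulfI two_neq0); rewrite double_catalanE mulrN -[X in _ = - X]natrM gcatalan0l.
have q0 : q%:R = 0 :> F.
  have [p pp pq] : exists2 p, prime p & (p %| q)%N.
    by exists (pdiv q); [apply: pdiv_prime | apply: pdiv_dvd].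
  have pF : p \in [pchar F] by apply: (pnatPpi q_char); rewrite mem_primes pp q_gt0.
  by case/dvdnP: pq => m ->; rewrite natrM (pcharf0 pF) mulr0.
have Bq : (central q.-1)%:R = 0 :> F.
  by rewrite -catalan_exact prednK // natrM q0 mulr0.
rewrite Lucas_central ?prednK // natrM Bq !mulr0 sub0r.
have -> : ((j * q + q.-1).+1 = j.+1 * q + 0)%N by rewrite -addnS prednK // mulSn; lia.
by rewrite Lucas_central // bin0 muln1.
Qed.

End PrimePowerCongruences.

(** Abel summation; the two boundary terms will match the extreme terms of [g]. *)
Lemma sum_by_parts (R : nzRingType) (V : lmodType R) (a : nat -> R) (y : nat -> V) n :
  \sum_(j < n.+1) a j *: (y j.+1 - y j) =
  a n *: y n.+1 - a 0%N *: y 0%N - \sum_(j < n) (a j.+1 - a j) *: y j.+1.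
Proof.
elim: n => [|n IHn]; first by rewrite big_ord1 big_ord0 subr0 scalerBr.
rewrite big_ord_recr /= IHn big_ord_recr /= scalerBr scalerBl !opprD !opprK.
set S := - \sum_(i < n) _.
rewrite addrC -!addrA; congr (_ + _).
rewrite [a n *: _ + _]addrC [LHS]addrC -!addrA; congr (_ + _); congr (_ + _).
by rewrite addrC.
Qed.

Lemma tX_h (F : fieldType) (q i : nat) (x : {mpoly F[3]}) :
  [pchar F].-nat q -> 2%:R != 0 :> F -> (i < q - 1)%N ->
  t q x * h q i x = - g q i x.
Proof.
move=> qF two0 iq.
have q1 : (1 < q)%N by lia.
have q0 : (0 < q)%N by lia.
rewrite /h /g -scalerAr -scalerN; congr (_ *: _).
pose y j := x ^+ (j * (q - 1) + i + 1).
pose a j : F := (gcatalan (i - j) j)%:R.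
transitivity (\sum_(j < i.+1) a j *: (y j.+1 - y j)).
  rewrite mulr_sumr; apply: eq_bigr => j _.
  rewrite -scalerAr; congr (_ *: _).
  rewrite /t mulrBl -exprD -exprS /y; congr (x ^+ _ - x ^+ _); nia.
rewrite sum_by_parts big_ord_recl big_ord_recr /=.
(* The top index of [g] has low digit q-1, the exceptional case of the Catalan congruence. *)
have -> : (bump 0 i * (q - 1) + i = i * q + q.-1)%N by rewrite /bump /=; nia.
rewrite catalan_Lucas_pred // mul0n add0n.
have -> : a i = (gcatalan 0 i)%:R by rewrite /a subnn.
have -> : a 0%N = (catalan i)%:R by rewrite /a subn0 gcatalan0r.
have -> : y i.+1 = x ^+ (i * q + q.-1 + 1) by rewrite /y; congr (x ^+ _); nia.
have -> : \sum_(j < i) (a j.+1 - a j) *: y j.+1 =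
  \sum_(j < i) (catalan (bump 0 j * (q - 1) + i))%:R *:
    x ^+ (bump 0 j * (q - 1) + i + 1).
  apply: eq_bigr => j _; have ji := ltn_ord j.
  rewrite /bump /= add1n; congr (_ *: _).
  (* Interior indices have low digit i-j-1 < q-1, and [gcatalan_shift] at r = i-j-1 gives the same
     product. *)
  have -> : (j.+1 * (q - 1) + i = j.+1 * q + (i - j.+1))%N by nia.
  rewrite catalan_Lucas //; last by lia.
  rewrite /a gcatalan_shift -subSn // subSS natrD addrAC subrr add0r.
  by rewrite mulnC.
by rewrite /y mul0n add0n scaleNr !opprD opprK [RHS]addrA [RHS]addrC addrA.
Qed.

Theorem theorem17 (p e : nat) (F : finFieldType) :
  prime p -> odd p -> (0 < e)%N -> #|F| = ((p ^ e) ^ 2)%N ->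
  T2 F (p ^ e) = T F (p ^ e).
Proof.
move=> p_pr p_odd e_gt0 cardF.
have pF : p \in [pchar F].
  by apply: (card_finPcharP (n := e * 2)); rewrite // expnM.
have two0 : 2%:R != 0 :> F.
  rewrite -(dvdn_pcharf pF) dvdn_prime2 //.
  by apply/eqP => p2; rewrite p2 in p_odd.
have qF : [pchar F].-nat (p ^ e)%N by rewrite pnatX pnatE // pF.
rewrite /T2 /T; congr (_ + _).
rewrite mulr_sumr -sumrN; apply: eq_bigr => i _; have iq := ltn_ord i.
rewrite -!mulNr -tX_h // exprS.
(* The outer factors in Y and Z each raise an exponent by one; i < q-1 keeps the subtraction
   exact. *)
have -> : (p ^ e - i.+1 = (p ^ e - 2 - i).+1)%N by lia.
by rewrite exprS; ring.
Qed.
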